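(* Let $\lambda_1>\lambda_2>0$. Suppose that $Ku^{\lambda_2}\neq 0$ and that there exists $\sigma>0$ such that $$\frac{\lambda_1}{2} R(u^{\lambda_2}, y^{\lambda_2}) > \sigma + J(\hat{u}, \hat{y}) - J(u^{\lambda_2}, y^{\lambda_2}),$$ where $(\hat u,\hat y)$ is the solution of the problem of minimizing $J(u,y)$ over $(u,y)\in\mathbb{R}^n\times\mathbb{R}^m$ subject to $Ku=y$. Then there exists $\omega>0$ such that the minimizer $(u^{\lambda_1,\lambda_2}_\omega, y^{\lambda_1,\lambda_2}_\omega)$ of $A^{\lambda_1,\lambda_2}_\omega$ over $\mathbb{R}^n\times\mathbb{R}^m$ satisfies $$R(u^{\lambda_1,\lambda_2}_\omega, y^{\lambda_1,\lambda_2}_\omega) < R(u^{\lambda_2}, y^{\lambda_2}).$$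
   Context: Setting: $n,m,k$ are positive integers with $m\le n$; $A\in\mathbb{R}^{k\times n}$ and $K\in\mathbb{R}^{m\times n}$ are matrices such that the row vectors of $A$ and $K$ together span $\mathbb{R}^n$ (so that $A^TA+\alpha K^TK$ is invertible for every $\alpha>0$); $b\in\mathbb{R}^k$ is a given vector; $\rho>0$ is a given constant; $\|\cdot\|$ is the Euclidean norm. For $(u,y)\in\mathbb{R}^n\times\mathbb{R}^m$ define $$J(u,y)=\tfrac12\|Au-b\|^2+\tfrac{\rho}{2}\|y\|^2,\qquad R(u,y)=\|Ku-y\|^2,$$ and for $\lambda>0$ define $P^\lambda(u,y)=J(u,y)+\tfrac{\lambda}{2}R(u,y)$. The pair $(u^\lambda,y^\lambda)$ denotes the minimizer of $P^\lambda$ over $\mathbb{R}^n\times\mathbb{R}^m$, given by $$u^\lambda=\Big(A^TA+\tfrac{\rho\lambda}{\rho+\lambda}K^TK\Big)^{-1}A^Tb,\qquad y^\lambda=\tfrac{\lambda}{\rho+\lambda}Ku^\lambda.$$ The minimizer of $J(u,y)$ subject to $Ku=y$ is $\hat u=(A^TA+\rho K^TK)^{-1}A^Tb$, $\hat y=K\hat u$. For $\lambda_1>\lambda_2>0$ and $\omega>0$, the penalty adversarial functional on $\mathbb{R}^n\times\mathbb{R}^m$ is $$A^{\lambda_1,\lambda_2}_\omega(u,y)=\begin{cases}J(u,y)+\frac{\lambda_1}{2}R(u,y)+\omega\left[J(u,y)-J(u^{\lambda_2},y^{\lambda_2})\right]^2, & \text{if } J(u,y)>J(u^{\lambda_2},y^{\lambda_2}),\\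 J(u,y)+\frac{\lambda_1}{2}R(u,y), & \text{if } J(u,y)\le J(u^{\lambda_2},y^{\lambda_2}).\end{cases}$$ *)

(* Defs.v *)
From HB Require Import structures.
From mathcomp Require Import all_boot all_order all_algebra.
From mathcomp Require Import ring lra.
From mathcomp Require Import classical_sets reals.

Set Implicit Arguments.
Unset Strict Implicit.
Unset Printing Implicit Defensive.

Import Order.TTheory GRing.Theory Num.Theory.
Local Open Scope classical_set_scope.
Local Open Scope ring_scope.

(* The library norm `|x| on matrices is the sup norm, hence this one. *)
Definition enorm (R : realType) (d : nat) (x : 'cV[R]_d) : R :=
  Num.sqrt (\sum_(i < d) x i 0 ^+ 2).

Definition minimizer_on (R : realType) (T : Type) (S : set T) (f : T -> R)
    (p : T) : Prop :=
  S p /\ forall q, S q -> f p <= f q.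

Section Penalty.
Variables (R : realType) (n m k : nat).
Variables (A : 'M[R]_(k, n)) (K : 'M[R]_(m, n)) (b : 'cV[R]_k) (rho : R).
Implicit Type p : 'cV[R]_n * 'cV[R]_m.

Definition J_cost p : R :=
  2^-1 * enorm (A *m p.1 - b) ^+ 2 + rho / 2 * enorm p.2 ^+ 2.

Definition R_residual p : R := enorm (K *m p.1 - p.2) ^+ 2.

Definition P_penalty (lambda : R) p : R :=
  J_cost p + lambda / 2 * R_residual p.

(* [p2] is meant to be the minimizer of [P_penalty lambda2]; the functional
   depends on lambda2 only through it. *)
Definition A_adversarial (lambda1 omega : R) (p2 : 'cV[R]_n * 'cV[R]_m) p : R :=
  if J_cost p2 < J_cost p then
    J_cost p + lambda1 / 2 * R_residual p + omega * (J_cost p - J_cost p2) ^+ 2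
  else
    J_cost p + lambda1 / 2 * R_residual p.

Definition feasible : set ('cV[R]_n * 'cV[R]_m) := [set p | K *m p.1 = p.2].

Definition u_formula (alpha : R) : 'cV[R]_n :=
  invmx (A^T *m A + alpha *: (K^T *m K)) *m (A^T *m b).

End Penalty.

Section ClosedForms.
Variable R : realType.

Let dot d (x y : 'cV[R]_d) : R := (x^T *m y) 0 0.

Let sqE d (x : 'cV[R]_d) : enorm x ^+ 2 = dot x x.
Proof.
rewrite /enorm sqr_sqrtr; last by apply: sumr_ge0 => i _; exact: sqr_ge0.
by rewrite /dot mxE; apply: eq_bigr => i _; rewrite mxE expr2.
Qed.

Let sq_eq0 d (x : 'cV[R]_d) : enorm x ^+ 2 = 0 -> x = 0.
Proof.
rewrite /enorm sqr_sqrtr; last by apply: sumr_ge0 => i _; exact: sqr_ge0.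
move/eqP; rewrite psumr_eq0 => [/allP x0|i _]; last exact: sqr_ge0.
apply/matrixP => i j; rewrite ord1 mxE; apply/eqP.
by have := x0 i (mem_index_enum _); rewrite /= sqrf_eq0.
Qed.

Let wsq_eq0 d c (x : 'cV[R]_d) : 0 < c -> (c * enorm x ^+ 2 == 0) = (x == 0).
Proof.
move=> c0; rewrite mulrI_eq0; last exact/lregP/lt0r_neq0.
apply/eqP/eqP => [/sq_eq0 //|->].
by rewrite sqE /dot mulmx0 mxE.
Qed.

Let wsq_ge0 d c (x : 'cV[R]_d) : 0 < c -> 0 <= c * enorm x ^+ 2.
Proof. by move=> c0; rewrite mulr_ge0 ?sqr_ge0 ?ltW. Qed.

Let dotC d (x y : 'cV[R]_d) : dot x y = dot y x.
Proof. by rewrite /dot -[x^T *m y]trmxK trmx_mul trmxK mxE. Qed.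

Let dotDr d (x y z : 'cV[R]_d) : dot x (y + z) = dot x y + dot x z.
Proof. by rewrite /dot mulmxDr mxE. Qed.

Let dotDl d (x y z : 'cV[R]_d) : dot (y + z) x = dot y x + dot z x.
Proof. by rewrite dotC dotDr !(dotC x). Qed.

Let dotZl d a (x y : 'cV[R]_d) : dot (a *: x) y = a * dot x y.
Proof. by rewrite /dot linearZ /= -scalemxAl mxE. Qed.

Let dotBr d (x y z : 'cV[R]_d) : dot x (y - z) = dot x y - dot x z.
Proof. by rewrite /dot mulmxBr !mxE. Qed.

Let sqD d (x y : 'cV[R]_d) :
  enorm (x + y) ^+ 2 = enorm x ^+ 2 + 2 * dot x y + enorm y ^+ 2.
Proof. rewrite !sqE dotDl !dotDr (dotC y x); ring. Qed.

Variables (n m k : nat).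
Variables (A : 'M[R]_(k, n)) (K : 'M[R]_(m, n)) (b : 'cV[R]_k) (rho : R).
Hypothesis AK : row_full (col_mx A K).

Let ker_AK (u : 'cV[R]_n) : A *m u = 0 -> K *m u = 0 -> u = 0.
Proof.
move=> Au Ku; have : col_mx A K *m u = 0 by rewrite mul_col_mx Au Ku col_mx0.
by move/(congr1 (mulmx (pinvmx (col_mx A K)))); rewrite mulmxA mulVpmx // mul1mx mulmx0.
Qed.

Lemma normal_unitmx (alpha : R) : 0 < alpha ->
  A^T *m A + alpha *: (K^T *m K) \in unitmx.
Proof.
move=> a0; rewrite -unitmx_tr -row_free_unit -kermx_eq0; apply/rowV0P => v.
move=> /sub_kermxP vM; set u := v^T.
have Mu : (A^T *m A + alpha *: (K^T *m K)) *m u = 0.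
  by rewrite -[LHS]trmxK trmx_mul /u trmxK vM trmx0.
have : enorm (A *m u) ^+ 2 + alpha * enorm (K *m u) ^+ 2 = 0.
  rewrite !sqE /dot !trmx_mul -!mulmxA.
  have := congr1 (fun w => (u^T *m w) 0 0) Mu.
  rewrite mulmxDl -scalemxAl mulmxDr -scalemxAr mulmx0 -!mulmxA.
  by rewrite mxE [X in _ + X]mxE [RHS]mxE.
move/eqP; rewrite paddr_eq0 ?sqr_ge0 ?wsq_ge0 //.
rewrite wsq_eq0 // => /andP[/eqP/sq_eq0 Au /eqP Ku].
by apply: trmx_inj; rewrite trmx0; exact: ker_AK.
Qed.

Let normal_dot (alpha : R) (h : 'cV[R]_n) : 0 < alpha ->
  let u := u_formula A K b alpha in
  dot (A *m u - b) (A *m h) + alpha * dot (K *m u) (K *m h) = 0.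
Proof.
move=> a0 u.
have Mu : (A^T *m A + alpha *: (K^T *m K)) *m u = A^T *m b.
  by rewrite /u /u_formula mulKVmx // normal_unitmx.
rewrite (dotC (_ - b)) dotBr (dotC (K *m u)) /dot !trmx_mul -!mulmxA -Mu.
rewrite mulmxDl mulmxDr -scalemxAl -scalemxAr -!mulmxA.
rewrite [X in _ - X]mxE [X in _ - (_ + X)]mxE; ring.
Qed.

Lemma P_penalty_minimizerP (lambda : R) (p : 'cV[R]_n * 'cV[R]_m) :
  0 < rho -> 0 < lambda ->
  let u := u_formula A K b (rho * lambda / (rho + lambda)) in
  minimizer_on setT (P_penalty A K b rho lambda) p <->
  p = (u, (lambda / (rho + lambda)) *: (K *m u)).
Proof.
move=> r0 l0 u; set y := _ *: _.
have rl0 : rho + lambda != 0 by rewrite gt_eqF ?addr_gt0.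
have expand q : P_penalty A K b rho lambda q = P_penalty A K b rho lambda (u, y)
    + (2^-1 * enorm (A *m (q.1 - u)) ^+ 2 + rho / 2 * enorm (q.2 - y) ^+ 2
       + lambda / 2 * enorm (K *m (q.1 - u) - (q.2 - y)) ^+ 2).
  rewrite /P_penalty /J_cost /R_residual /=.
  set h := q.1 - u; set g := q.2 - y.
  have eq1 : q.1 = u + h by rewrite /h addrC subrK.
  have eq2 : q.2 = y + g by rewrite /g addrC subrK.
  have -> : A *m q.1 - b = (A *m u - b) + A *m h by rewrite eq1 mulmxDr addrAC.
  have -> : K *m q.1 - q.2 = (K *m u - y) + (K *m h - g).
    by rewrite eq1 {1}eq2 mulmxDr opprD addrACA.
  rewrite {1}eq2 (sqD (_ - b)) (sqD y) (sqD (_ - y)).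
  have a0 : 0 < rho * lambda / (rho + lambda) by rewrite divr_gt0 ?mulr_gt0 ?addr_gt0.
  have := normal_dot h a0; rewrite -/u => /= H.
  have -> : K *m u - y = (rho / (rho + lambda)) *: (K *m u).
    rewrite /y -{1}[K *m u]scale1r -scalerBl; congr (_ *: _); field; exact: rl0.
  have yg : dot y g = lambda / (rho + lambda) * dot (K *m u) g by rewrite dotZl.
  rewrite dotZl (dotBr (K *m u)) yg.
  have {H}-> : dot (A *m u - b) (A *m h)
     = - (rho * lambda / (rho + lambda) * dot (K *m u) (K *m h)) by lra.
  field; exact: rl0.
have nneg q : 0 <= 2^-1 * enorm (A *m (q.1 - u)) ^+ 2 + rho / 2 * enorm (q.2 - y) ^+ 2
       + lambda / 2 * enorm (K *m (q.1 - u) - (q.2 - y)) ^+ 2.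
  by rewrite !addr_ge0 ?wsq_ge0 ?divr_gt0 ?invr_gt0.
split=> [[_ /(_ (u, y) I)]|->]; last by split=> // q _; rewrite (expand q) lerDl.
rewrite (expand p) gerDl => le0.
have /eqP : 2^-1 * enorm (A *m (p.1 - u)) ^+ 2 + rho / 2 * enorm (p.2 - y) ^+ 2
       + lambda / 2 * enorm (K *m (p.1 - u) - (p.2 - y)) ^+ 2 = 0.
  by apply/eqP; rewrite eq_le le0 nneg.
have l2 : 0 < lambda / 2 by rewrite divr_gt0.
have r2 : 0 < rho / 2 by rewrite divr_gt0.
have h2 : 0 < 2^-1 :> R by rewrite invr_gt0.
rewrite paddr_eq0 ?addr_ge0 ?wsq_ge0 //.
rewrite paddr_eq0 ?wsq_ge0 //.
rewrite !wsq_eq0 // => /andP[/andP[/eqP Ah /eqP g0]] /eqP.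
rewrite g0 subr0 => Kh; have /eqP := ker_AK Ah Kh.
rewrite subr_eq0 => /eqP pu; move/eqP: g0; rewrite subr_eq0 => /eqP py.
by rewrite [p]surjective_pairing pu py.
Qed.

Lemma J_cost_minimizerP (p : 'cV[R]_n * 'cV[R]_m) :
  0 < rho ->
  let u := u_formula A K b rho in
  minimizer_on (feasible K) (J_cost A b rho) p <-> p = (u, K *m u).
Proof.
move=> r0 u.
have expand v : J_cost A b rho (v, K *m v) = J_cost A b rho (u, K *m u)
    + (2^-1 * enorm (A *m (v - u)) ^+ 2 + rho / 2 * enorm (K *m (v - u)) ^+ 2).
  rewrite /J_cost /=; set h := v - u.
  have -> : A *m v - b = (A *m u - b) + A *m h.
    by rewrite addrAC /h mulmxBr [A *m u + _]addrC subrK.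
  have -> : K *m v = K *m u + K *m h by rewrite /h mulmxBr addrC subrK.
  rewrite (sqD (_ - b)) (sqD (K *m u)).
  have := normal_dot h r0; rewrite -/u => /= H.
  have {H}-> : dot (A *m u - b) (A *m h)
     = - (rho * dot (K *m u) (K *m h)) by lra.
  by field.
have r2 : 0 < rho / 2 by rewrite divr_gt0.
have h2 : 0 < 2^-1 :> R by rewrite invr_gt0.
have nneg v : 0 <= 2^-1 * enorm (A *m (v - u)) ^+ 2
    + rho / 2 * enorm (K *m (v - u)) ^+ 2.
  by rewrite addr_ge0 ?wsq_ge0.
case: p => v z; split=> [[fz]|[-> ->]]; last first.
  by split=> // -[w x] wx; rewrite -[x]wx (expand w) lerDl.
rewrite -[z]fz /= => {z fz}.
move=> /(_ (u, K *m u) erefl); rewrite (expand v) gerDl => le0.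
have /eqP : 2^-1 * enorm (A *m (v - u)) ^+ 2
    + rho / 2 * enorm (K *m (v - u)) ^+ 2 = 0.
  by apply/eqP; rewrite eq_le le0 nneg.
rewrite paddr_eq0 ?wsq_ge0 //.
rewrite !wsq_eq0 // => /andP[/eqP Ah /eqP Kh].
by have /eqP := ker_AK Ah Kh; rewrite subr_eq0 => /eqP ->.
Qed.

End ClosedForms.

(* Main.v *)
(** The adversarial functional is [phi(J) + (lambda1 / 2) R] with
    [phi(j) = j + omega max(0, j - J(p2))^2] convex.  Fix [lambda2 < lambda < lambda1]
    and let [p] be the minimizer of [P^lambda]; it differs from [p2] because
    [K u2 <> 0], hence [J(p2) < J(p)] and [R(p) < R(p2)].  Choosing [omega] so that
    [phi'(J(p)) = lambda1 / lambda], the tangent inequality for [phi] at [J(p)]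
    shows that the excess of the adversarial functional over its value at [p] is
    at least [lambda1 / lambda] times the excess of [P^lambda], so [p] is also its
    unique minimizer. *)

Require Import Defs.
From mathcomp Require Import all_boot all_order all_algebra.
From mathcomp Require Import ring lra.
From mathcomp Require Import classical_sets reals.

Import Order.TTheory GRing.Theory Num.Theory.
Local Open Scope classical_set_scope.
Local Open Scope ring_scope.

Section Penalty.
Local Set Implicit Arguments.
Local Unset Strict Implicit.
Variables (R : realType) (n m k : nat).
Variables (A : 'M[R]_(k, n)) (K : 'M[R]_(m, n)) (b : 'cV[R]_k) (rho : R).
Implicit Types p q : 'cV[R]_n * 'cV[R]_m.

Local Notation J := (J_cost A b rho).
Local Notation Res := (R_residual K).
Local Notation P := (P_penalty A K b rho).

Lemma unique_P_penalty_minimizer (lambda : R) :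
  row_full (col_mx A K) -> 0 < rho -> 0 < lambda ->
  exists p, unique (minimizer_on setT (P lambda)) p.
Proof.
move=> AK r0 l0; eexists; split; first exact/(P_penalty_minimizerP b AK _ r0 l0).
by move=> q /(P_penalty_minimizerP b AK _ r0 l0) ->.
Qed.

Lemma P_penalty_lt (lambda : R) p q :
  unique (minimizer_on setT (P lambda)) p -> q <> p -> P lambda p < P lambda q.
Proof.
move=> [[_ minp] uniq] neq_qp; rewrite lt_neqAle minp // andbT.
apply/eqP => eqP; apply: neq_qp; symmetry; apply: uniq.
by split=> // r _; rewrite -eqP; exact: minp.
Qed.

(** Adding the two comparisons cancels [J] and leaves [(lambda' - lambda) * (Res p - Res p') > 0];
    the first comparison then turns the drop in [Res] into a strict rise in [J]. *)
Lemma penalty_tradeoff (lambda lambda' : R) p p' :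
  0 < lambda -> lambda < lambda' ->
  P lambda p <= P lambda p' -> P lambda' p' < P lambda' p ->
  J p < J p' /\ Res p' < Res p.
Proof.
rewrite /P_penalty => l0 ll le_p lt_p'.
have RR : Res p' < Res p.
  rewrite -subr_gt0 -(pmulr_rgt0 _ (_ : 0 < lambda' - lambda)) ?subr_gt0 //; nra.
by split=> //; nra.
Qed.

Lemma A_adversarial_tangent (lambda1 lambda omega : R) p2 p q :
  0 < lambda -> 0 <= omega -> J p2 < J p ->
  lambda1 / lambda = 1 + 2 * omega * (J p - J p2) ->
  lambda1 / lambda * (P lambda q - P lambda p) <=
  A_adversarial A K b rho lambda1 omega p2 q
  - A_adversarial A K b rho lambda1 omega p2 p.
Proof.
move=> l0 w0 Jp slope; rewrite /A_adversarial Jp /P_penalty.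
have -> : lambda1 / lambda * (J q + lambda / 2 * Res q - (J p + lambda / 2 * Res p))
    = lambda1 / lambda * (J q - J p) + lambda1 / 2 * (Res q - Res p).
  by field; rewrite gt_eqF.
(* With [d = J p - J p2], the right side exceeds the left by [omega * (J q - J p) ^+ 2] in the first
   case and by [omega * d ^+ 2 + 2 * omega * d * (J p2 - J q)] in the second. *)
rewrite slope; case: ltP => Jq.
  have := mulr_ge0 w0 (sqr_ge0 (J q - J p)); nra.
have := mulr_ge0 w0 (sqr_ge0 (J p - J p2)).
have := mulr_ge0 (mulr_ge0 w0 (ltW (_ : 0 < J p - J p2))) (_ : 0 <= J p2 - J q).
by rewrite !subr_gt0 subr_ge0 => /(_ Jp Jq); nra.
Qed.

End Penalty.

Theorem theorem3p4 (R : realType) (n m k : nat)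
    (A : 'M[R]_(k, n)) (K : 'M[R]_(m, n)) (b : 'cV[R]_k)
    (rho lambda1 lambda2 : R)
    (u2 : 'cV[R]_n) (y2 : 'cV[R]_m) (uhat : 'cV[R]_n) (yhat : 'cV[R]_m)
    (n_gt0 : (0 < n)%N) (m_gt0 : (0 < m)%N) (k_gt0 : (0 < k)%N)
    (le_mn : (m <= n)%N)
    (AK_span : row_full (col_mx A K))
    (rho_gt0 : 0 < rho) (lambda2_gt0 : 0 < lambda2)
    (lt_lambda : lambda2 < lambda1)
    (min_2 : minimizer_on setT (P_penalty A K b rho lambda2) (u2, y2))
    (min_hat : minimizer_on (feasible K) (J_cost A b rho) (uhat, yhat))
    (Ku2_neq0 : K *m u2 != 0)
    (gap : exists sigma : R, 0 < sigma /\
       sigma + J_cost A b rho (uhat, yhat) - J_cost A b rho (u2, y2)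
         < lambda1 / 2 * R_residual K (u2, y2)) :
  exists omega : R, 0 < omega /\
    exists (u : 'cV[R]_n) (y : 'cV[R]_m),
      unique (minimizer_on setT
                (A_adversarial A K b rho lambda1 omega (u2, y2))) (u, y) /\
      R_residual K (u, y) < R_residual K (u2, y2).
Proof.
(* Any value strictly between would do: [lambda2 < lambda] gives the strict drop of the residual,
   [lambda < lambda1] makes [omega] positive. *)
pose lambda := (lambda1 + lambda2) / 2.
have ltl2 : lambda2 < lambda by rewrite /lambda; lra.
have ltl1 : lambda < lambda1 by rewrite /lambda; lra.
have l0 : 0 < lambda by exact: lt_trans ltl2.
have [[u y] minp] := unique_P_penalty_minimizer b AK_span rho_gt0 l0.
have neq_p : (u2, y2) <> (u, y).
  (* If the minimizers coincided, the two closed forms of [y2] would give the nonzero vector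
     [K *m u2] the same factor, [lambda / (rho + lambda) = lambda2 / (rho + lambda2)], which forces
     [lambda = lambda2]. *)
  move=> eq_p; have [minp0 _] := minp; move: minp0 min_2.
  rewrite -eq_p => /(P_penalty_minimizerP b AK_span _ rho_gt0 l0)[{1}<- ->].
  move=> /(P_penalty_minimizerP b AK_span _ rho_gt0 lambda2_gt0)[<-].
  move=> /eqP; rewrite -subr_eq0 -scalerBl scaler_eq0 (negPf Ku2_neq0) orbF.
  rewrite subr_eq0 eqr_div ?lt0r_neq0 ?addr_gt0 // => /eqP eq_frac.
  have := mulr_gt0 rho_gt0 (_ : 0 < lambda - lambda2); rewrite subr_gt0 => /(_ ltl2).
  by apply/negP; rewrite -leNgt; nra.
have [J_lt R_lt] : J_cost A b rho (u2, y2) < J_cost A b rho (u, y) /\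
    R_residual K (u, y) < R_residual K (u2, y2).
  apply: (penalty_tradeoff lambda2_gt0 ltl2); first by case: min_2 => _; exact.
  exact: P_penalty_lt.
pose dJ := J_cost A b rho (u, y) - J_cost A b rho (u2, y2).
have dJ_gt0 : 0 < dJ by rewrite subr_gt0.
pose omega := (lambda1 / lambda - 1) / (2 * dJ).
have omega_gt0 : 0 < omega.
  by rewrite divr_gt0 ?mulr_gt0 // subr_gt0 ltr_pdivlMr ?mul1r.
have slope : lambda1 / lambda = 1 + 2 * omega * dJ.
  by rewrite /omega; field; rewrite !gt_eqF.
have tangent q := A_adversarial_tangent K q l0 (ltW omega_gt0) J_lt slope.
have ratio_gt0 : 0 < lambda1 / lambda by rewrite divr_gt0 // (lt_trans l0).
exists omega; split=> //; exists u, y; split=> //; split.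
  split=> // q _; rewrite -subr_ge0; apply: le_trans (tangent q).
  by rewrite pmulr_rge0 // subr_ge0; have [[_ minP] _] := minp; exact: minP.
(* Uniqueness is inherited: by [tangent], another minimizer [q] has [P_penalty] at [lambda] no
   larger than at [(u, y)], so it minimizes that penalty too. *)
move=> q [_ minq]; case: (minp) => _; apply; split=> // r _.
have := minq (u, y) I; rewrite -subr_le0 => /(le_trans (tangent q)).
rewrite pmulr_rle0 // subr_le0 => /le_trans; apply.
by have [[_ minP] _] := minp; exact: minP.
Qed.
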